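(* Let $\mathcal{B}$ be a quasi-greedy basis of a quasi-Banach space $\mathbb{X}$. Then there is a renorming of $\mathbb{X}$ with respect to which $C_{qg}=\Lambda_t=\Lambda_u=1$.
   Context: The scalar field is $\mathbb{R}$ or $\mathbb{C}$. A quasi-norm satisfies the axioms of a norm except that the triangle inequality is replaced by $\Vert f+g\Vert\le\kappa(\Vert f\Vert+\Vert g\Vert)$ for some $\kappa\ge1$ (it need not be a continuous function); a quasi-Banach space is a vector space complete for the topology of a quasi-norm. A renorming of $(\mathbb{X},\Vert\cdot\Vert)$ is another quasi-norm on $\mathbb{X}$ inducing the same topology, i.e., equivalent to $\Vert\cdot\Vert$. A basis of $\mathbb{X}$ is a sequence $\mathcal{B}=(\mathbf{x}_n)_{n=1}^\infty$ whose closed linear span is $\mathbb{X}$ and for which there is a (unique) sequence $(\mathbf{x}_n^* )_{n=1}^\infty$ in $\mathbb{X}^*$ with $\mathbf{x}_n^*(\mathbf{x}_k)=\delta_{k,n}$. It is $M$-bounded if $\sup_n\Vert\mathbf{x}_n\Vert\,\Vert\mathbf{x}_n^*\Vert<\infty$ and semi-normalized if $0<\inf_n\Vert\mathbf{x}_n\Vert\le\sup_n\Vert\mathbf{x}_n\Vert<\infty$. Put $\mathrm{supp}(f)=\{n:\mathbf{x}_n^*(f)\ne0\}$; for finite $A\subseteq\mathbb{N}$, $S_A(f)=\sum_{n\in A}\mathbf{x}_n^*(f)\mathbf{x}_n$ and $S_{A^c}(f)=f-S_A(f)$. A set $A\subseteq\mathbb{N}$ is a greedy set of $f$ if $|\mathbf{x}_k^*(f)|\le|\mathbf{x}_n^*(f)|$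 for all $n\in A$, $k\in\mathbb{N}\setminus A$ (an infinite $A$ is a greedy set of $f$ iff $\mathrm{supp}(f)\subseteq A$). A quasi-greedy basis is an $M$-bounded semi-normalized basis for which there is $C<\infty$ with $\Vert S_A(f)\Vert\le C\Vert f\Vert$ for all $f$ and all finite greedy sets $A$ of $f$. $C_{qg}$ is the smallest $C$ such that $\Vert S_{A\setminus B}(f)\Vert\le C\Vert f\Vert$ for all $f$ and all finite greedy sets $B\subseteq A$ of $f$. Let $\mathrm{sign}(0)=1$ and $\mathrm{sign}(a)=a/|a|$ for $a\ne0$. For finite $A$, $\mathcal{U}(f,A)=\min_{n\in A}|\mathbf{x}_n^*(f)|\sum_{n\in A}\mathrm{sign}(\mathbf{x}_n^*(f))\mathbf{x}_n$ (zero if $A=\emptyset$) and $\mathcal{T}(f,A)=\mathcal{U}(f,A)+S_{A^c}(f)$; if $A$ is infinite with $\mathrm{supp}(f)\subseteq A$, $\mathcal{U}(f,A)=\mathcal{T}(f,A)=0$. Put $\Lambda_u=\sup\{\Vert\mathcal{U}(f,A)\Vert:A\text{ greedy set of }f,\ \Vert f\Vert\le1\}$ and $\Lambda_t=\sup\{\Vert\mathcal{T}(f,A)\Vert:A\text{ greedy set of }f,\ \Vert f\Vert\le1\}$. All constants are computed with respect to the quasi-norm under consideration. *)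

(* Defs.v *)
From HB Require Import structures.
From mathcomp Require Import all_boot all_order all_algebra.
From mathcomp Require Import complex.
From mathcomp Require Import all_classical all_reals all_analysis.
Set Implicit Arguments.
Unset Strict Implicit.
Unset Printing Implicit Defensive.
Import Order.TTheory GRing.Theory Num.Theory.
Import numFieldNormedType.Exports.
Local Open Scope classical_set_scope.
Local Open Scope ring_scope.

Variant scalars := RealScalars | ComplexScalars.

Definition scalarField (R : realType) (s : scalars) : numFieldType :=
  match s with
  | RealScalars => R
  | ComplexScalars => R[i]%C
  end.

Definition of_real (R : realType) (s : scalars) : R -> scalarField R s :=
  match s with
  | RealScalars => fun a => a
  | ComplexScalars => fun a => a%:C%C
  end.

(* The norm [`|a|] of [a : scalarField R s] lives in [scalarField R s]; the quasi-norms
   below are real-valued, hence this real-valued version of it. *)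
Definition modulus (R : realType) (s : scalars) : scalarField R s -> R :=
  match s with
  | RealScalars => fun a : R => `|a|
  | ComplexScalars => fun a : R[i]%C => complex.Re `|a|
  end.

Lemma of_real_modulus (R : realType) (s : scalars) (a : scalarField R s) :
  of_real s (modulus a) = `|a|.
Proof. by case: s a => //= -[a b]. Qed.

Section QuasiNorms.
Context (R : realType) (s : scalars) (X : lmodType (scalarField R s)).
Implicit Types (N : X -> R) (f g : X).

Definition quasi_norm N : Prop :=
  [/\ forall f, 0 <= N f,
      forall f, N f = 0 -> f = 0,
      forall (a : scalarField R s) f, N (a *: f) = modulus a * N f
    & exists2 kappa : R, 1 <= kappa &
        forall f g, N (f + g) <= kappa * (N f + N g)].

Definition qball N f (e : R) : set X := [set g | N (f - g) < e].

(* A ball of a quasi-norm need not be open, but it is a neighbourhood of its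
   centre. *)
Definition qnbhs N f : set_system X := nbhs_ball_ (qball N) f.

Definition qcauchy N (u : nat -> X) : Prop :=
  forall e : R, 0 < e -> exists n0 : nat,
    forall m n : nat, (n0 <= m)%N -> (n0 <= n)%N -> N (u m - u n) < e.

Definition quasi_banach N : Prop :=
  quasi_norm N /\
  forall u : nat -> X, qcauchy N u -> exists f, u @ \oo `=>` qnbhs N f.

Definition renorming N N' : Prop :=
  quasi_norm N' /\ forall f, qnbhs N' f = qnbhs N f.

Definition in_dual N (phi : {scalar X}) : Prop :=
  forall f, phi g @[g --> qnbhs N f] --> phi f.

Definition dual_norm N (phi : {scalar X}) : \bar R :=
  ereal_sup [set (modulus (phi f))%:E | f in [set f | N f <= 1]].

Definition lin_span (x : nat -> X) : set X :=
  [set f | exists n (a : nat -> scalarField R s), f = \sum_(k < n) a k *: x k].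

Definition qclosure N (S : set X) : set X :=
  [set f | forall V, qnbhs N f V -> S `&` V !=set0].

End QuasiNorms.

Section Bases.
Context (R : realType) (s : scalars) (X : lmodType (scalarField R s)).
Variables (N : X -> R) (x : nat -> X) (xs : nat -> {scalar X}).
Implicit Types (f : X) (A B : set nat).

Definition basis : Prop :=
  [/\ qclosure N (lin_span x) = setT,
      forall n, in_dual N (xs n)
    & forall n k, xs n (x k) = (k == n)%:R].

Definition M_bounded : Prop :=
  (ereal_sup (range (fun n => (N (x n))%:E * dual_norm N (xs n))) < +oo)%E.

Definition semi_normalized : Prop :=
  (0 < ereal_inf (range (fun n => (N (x n))%:E)) /\
   ereal_sup (range (fun n => (N (x n))%:E)) < +oo)%E.

(* Meaningful for finite [A] only, and used only then. *)
Definition partial_sum A f : X := \sum_(n \in A) xs n f *: x n.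

Definition greedy f A : Prop :=
  forall n k, A n -> ~ A k -> modulus (xs k f) <= modulus (xs n f).

Definition quasi_greedy : Prop :=
  exists C : R, forall f A, finite_set A -> greedy f A ->
    N (partial_sum A f) <= C * N f.

Definition quasi_greedy_basis : Prop :=
  [/\ basis, M_bounded, semi_normalized & quasi_greedy].

Definition C_qg : \bar R :=
  ereal_inf [set C%:E | C in [set C : R | forall f A B,
    finite_set A -> greedy f A -> greedy f B -> B `<=` A ->
    N (partial_sum (A `\` B) f) <= C * N f]].

Definition sign (a : scalarField R s) : scalarField R s :=
  if a == 0 then 1 else a / `|a|.

(* The infimum is a minimum when [A] is finite and nonempty. An infinite
   greedy set of [f] contains the support of [f], since the coefficients of
   [f] tend to zero; the two operators vanish there. *)
Definition trunc_U f A : X :=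
  if `[< finite_set A >] then
    of_real s (inf [set modulus (xs n f) | n in A])
      *: \sum_(n \in A) sign (xs n f) *: x n
  else 0.

Definition trunc_T f A : X :=
  if `[< finite_set A >] then trunc_U f A + (f - partial_sum A f) else 0.

Definition Lambda_u : \bar R :=
  ereal_sup [set y | exists f A,
    [/\ greedy f A, N f <= 1 & y = (N (trunc_U f A))%:E]].

Definition Lambda_t : \bar R :=
  ereal_sup [set y | exists f A,
    [/\ greedy f A, N f <= 1 & y = (N (trunc_T f A))%:E]].

End Bases.

(* Main.v *)
Require Import Defs.
From mathcomp Require Import all_boot all_order all_algebra.
From mathcomp Require Import complex ring lra.
From mathcomp Require Import all_classical all_reals all_analysis.

(* The new quasi-norm of [f] is the supremum of [N h] over all [h] obtained from
   [f] by iterating the operators [S_D], [f - S_D f] and [T(f, D)] along finite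
   greedy sets [D]. This makes those operators contractive, and only the
   equivalence with [N] is at stake (it also gives the quasi-triangle inequality
   for free). The iterates have a closed form: a difference of greedy
   projections of [f] plus a sum [m * sum_{n in B} sign(x_n^*(f)) x_n], where [B]
   lies in a finite greedy set of [f] and [m <= |x_n^*(f)|] on [B]. To bound that
   sum, convexity being unavailable: sums with unimodular coefficients dominate their
   subsums (all subsets are greedy), hence the sums with coefficients in [0, 1]
   times these signs, hence they are dominated by sums with coefficients of modulus
   in [1, 1 + d] for a small [d]. Cutting [B] along the levels [(1 + d)^j m] of the
   moduli then gives a geometric series, in which a finite but large number of
   levels is grouped so that the ratio beats the constant [kappa] of the
   quasi-triangle inequality. *)

Section Renorming.
Set Implicit Arguments.
Unset Strict Implicit.
Import Order.TTheory GRing.Theory Num.Theory.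
Local Open Scope classical_set_scope.
Local Open Scope ring_scope.

(** * Real-valued moduli and signs of real or complex scalars *)

Section Scalars.
Context (R : realType) (s : scalars).
Notation K := (scalarField R s).
Implicit Types (a b : K) (t : R).
Notation "t %:K" := (@of_real R s t) (at level 1, format "t %:K").

Lemma of_real_inj : injective (@of_real R s).
Proof. by case: s => //= u v [->]. Qed.

Lemma of_realD t u : (t + u)%:K = t%:K + u%:K.
Proof. by case: s => //=; rewrite rmorphD. Qed.

Lemma of_realM t u : (t * u)%:K = t%:K * u%:K.
Proof. by case: s => //=; rewrite rmorphM. Qed.

Lemma of_real0 : 0%:K = 0.
Proof. by case: s => //=; rewrite rmorph0. Qed.

Lemma of_real1 : 1%:K = 1.
Proof. by case: s => //=; rewrite rmorph1. Qed.

Lemma of_real_sum (I : Type) (r : seq I) (P : pred I) (F : I -> R) :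
  (\sum_(i <- r | P i) F i)%:K = \sum_(i <- r | P i) (F i)%:K.
Proof. by apply: (big_morph _ of_realD of_real0). Qed.

Lemma modulusM a b : modulus (a * b) = modulus a * modulus b.
Proof. by apply: of_real_inj; rewrite of_realM !of_real_modulus normrM. Qed.

Lemma modulus_eq0 a : (modulus a == 0) = (a == 0).
Proof. by rewrite -(inj_eq of_real_inj) of_real_modulus of_real0 normr_eq0. Qed.

Lemma modulus0 : modulus (0 : K) = 0.
Proof. by apply/eqP; rewrite modulus_eq0. Qed.

Lemma modulus1 : modulus (1 : K) = 1.
Proof. by apply: of_real_inj; rewrite of_real_modulus of_real1 normr1. Qed.

Lemma modulus_ge0 a : 0 <= modulus a.
Proof. by case: s a => //= -[u v]; rewrite sqrtr_ge0. Qed.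

Lemma modulus_gt0 a : (0 < modulus a) = (a != 0).
Proof. by rewrite lt_def modulus_ge0 modulus_eq0 andbT. Qed.

Lemma modulusN a : modulus (- a) = modulus a.
Proof. by apply: of_real_inj; rewrite !of_real_modulus normrN. Qed.

Lemma modulus_of_real t : modulus t%:K = `|t|.
Proof. by case: s => //=; rewrite expr0n addr0 sqrtr_sqr. Qed.

Lemma modulus_sign a : modulus (sign a) = 1.
Proof.
rewrite /sign; case: eqP => [_|/eqP a0]; first exact: modulus1.
apply: of_real_inj; rewrite of_real_modulus normrM normfV normr_id of_real1.
by rewrite mulfV // normr_eq0.
Qed.

Lemma modulus_mul_sign a : (modulus a)%:K * sign a = a.
Proof.
rewrite of_real_modulus /sign; case: eqP => [->|/eqP a0]; first by rewrite normr0 mul0r.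
by rewrite mulrC divfK // normr_eq0.
Qed.

Lemma signM a b : a != 0 -> b != 0 -> sign (a * b) = sign a * sign b.
Proof.
move=> a0 b0; rewrite /sign mulf_eq0 (negbTE a0) (negbTE b0) /= normrM.
by rewrite invfM mulrACA.
Qed.

Lemma sign_of_real_mul t a : 0 < t -> modulus a = 1 -> sign (t%:K * a) = a.
Proof.
move=> t0 a1; have Ea : `|a| = 1 by rewrite -of_real_modulus a1 of_real1.
have tK0 : t%:K != 0 by rewrite -modulus_gt0 modulus_of_real normr_gt0 gt_eqF.
have a0 : a != 0 by rewrite -modulus_eq0 a1 oner_eq0.
rewrite /sign mulf_eq0 (negbTE tK0) (negbTE a0) /= normrM Ea mulr1.
by rewrite -of_real_modulus modulus_of_real gtr0_norm // mulrC mulKf.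
Qed.

End Scalars.

Notation "t %:K" := (@of_real _ _ t) (at level 1, format "t %:K").

(** * Finite linear combinations of the basis and coordinate projections *)

Section Combinations.
Context (R : realType) (s : scalars) (X : lmodType (scalarField R s)).
Variable x : nat -> X.
Notation K := (scalarField R s).
Implicit Types (A B : set nat) (a b : nat -> K).

Definition comb a A : X := \sum_(n \in A) a n *: x n.

Lemma eq_comb a b A : (forall n, A n -> a n = b n) -> comb a A = comb b A.
Proof.
by move=> ab; apply: eq_fsbigr => n; rewrite inE => An; rewrite ab.
Qed.

Lemma comb0 a : comb a set0 = 0.
Proof. exact: fsbig_set0. Qed.

Lemma comb_eq0 a A : (forall n, A n -> a n = 0) -> comb a A = 0.
Proof. by move=> a0; apply: fsbig1 => n An; rewrite a0 // scale0r. Qed.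

Lemma combD a b A : finite_set A -> comb (fun n => a n + b n) A = comb a A + comb b A.
Proof.
move=> fA; rewrite /comb -fsbig_split //; apply: eq_fsbigr => n _.
by rewrite scalerDl.
Qed.

Lemma combZ c a A : finite_set A -> c *: comb a A = comb (fun n => c * a n) A.
Proof.
move=> fA; rewrite /comb !fsbig_finite // scaler_sumr.
by apply: eq_bigr => n _; rewrite scalerA.
Qed.

Lemma combU a A B : finite_set A -> finite_set B -> A `&` B = set0 ->
  comb a (A `|` B) = comb a A + comb a B.
Proof.
by move=> fA fB AB; rewrite /comb fsbigU0 // => n; rewrite AB.
Qed.

Lemma comb_setD a A B : finite_set A -> B `<=` A ->
  comb a (A `\` B) = comb a A - comb a B.
Proof.
move=> fA BA; have fB := sub_finite_set BA fA.
rewrite -{2}(setDUK BA) combU //; first by rewrite addrC addKr.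
  exact: finite_setD.
by rewrite setDE setICA setICr setI0.
Qed.

Lemma comb_widen a A B : B `<=` A ->
  comb a B = comb (fun n => if n \in B then a n else 0) A.
Proof.
move=> BA; rewrite [RHS]/comb -(@fsbig_widen _ _ _ _ B) //.
  by apply: eq_fsbigr => n ->.
by move=> n [_ Bn] /=; rewrite memNset // scale0r.
Qed.

Lemma finite_set_nat_bound A : finite_set A -> exists n, A `<=` `I_n.
Proof.
move=> /finite_seqP[r ->]; exists (\max_(i <- r) i).+1 => n /= nr.
by rewrite ltnS (@leq_bigmax_seq _ r xpredT id).
Qed.

Lemma comb_ord a A n : A `<=` `I_n ->
  comb a A = \sum_(k < n) (if nat_of_ord k \in A then a k else 0) *: x k.
Proof. by move=> An; rewrite (comb_widen _ An) /comb -fsbig_ord. Qed.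

Lemma comb_sum (m : nat) (c : nat -> nat -> K) A : finite_set A ->
  comb (fun n => \sum_(j < m) c j n) A = \sum_(j < m) comb (c j) A.
Proof.
move=> /finite_set_nat_bound[n An].
under [RHS]eq_bigr do rewrite (comb_ord _ An).
rewrite (comb_ord _ An) exchange_big /=; apply: eq_bigr => k _.
by rewrite -scaler_suml; case: ifP => // _; rewrite big1.
Qed.

Section Dual.
Variable xs : nat -> {scalar X}.
Hypothesis biorth : forall n k, xs n (x k) = (k == n)%:R.

Lemma coef_comb a A n : finite_set A ->
  xs n (comb a A) = if n \in A then a n else 0.
Proof.
move=> /finite_set_nat_bound[m Am]; rewrite (comb_ord _ Am) raddf_sum /=.
under eq_bigr => i _ do rewrite linearZ /= biorth.
have [nm|mn] := ltnP n m.
  rewrite (bigD1 (Ordinal nm)) //= eqxx mulr1 big1 ?addr0 // => i.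
  by rewrite -val_eqE /= => /negbTE ->; exact: mulr0.
rewrite memNset; last by move=> nA; have := Am _ nA; rewrite /= ltnNge mn.
rewrite big1 // => i _; rewrite ltn_eqF ?mulr0 //.
exact: leq_trans (ltn_ord i) mn.
Qed.

Lemma partial_sum_comb D a A : finite_set A ->
  partial_sum x xs D (comb a A) = comb a (D `&` A).
Proof.
move=> fA; rewrite [RHS](@comb_widen _ D); last exact: subIsetl.
apply: eq_comb => n Dn; rewrite coef_comb // in_setI.
by rewrite (mem_set Dn).
Qed.

Lemma coef_partial_sum A f n : finite_set A ->
  xs n (partial_sum x xs A f) = if n \in A then xs n f else 0.
Proof. exact: coef_comb. Qed.

Lemma partial_sumD A f g : finite_set A ->
  partial_sum x xs A (f + g) = partial_sum x xs A f + partial_sum x xs A g.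
Proof.
move=> fA; rewrite -[partial_sum _ _ _ f]/(comb _ _) -combD //.
by apply: eq_comb => n _; rewrite raddfD.
Qed.

Lemma partial_sumZ A c f : finite_set A ->
  partial_sum x xs A (c *: f) = c *: partial_sum x xs A f.
Proof.
move=> fA; rewrite -[partial_sum _ _ _ f]/(comb _ _) combZ //.
by apply: eq_comb => n _; rewrite linearZ.
Qed.

Lemma partial_sumB A f g : finite_set A ->
  partial_sum x xs A (f - g) = partial_sum x xs A f - partial_sum x xs A g.
Proof.
by move=> fA; rewrite partial_sumD // -scaleN1r partial_sumZ // scaleN1r.
Qed.

Lemma partial_sum_setD A B f : finite_set A -> B `<=` A ->
  partial_sum x xs (A `\` B) f = partial_sum x xs A f - partial_sum x xs B f.
Proof. exact: comb_setD. Qed.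

Lemma partial_sum_partial_sum A B f : finite_set B ->
  partial_sum x xs A (partial_sum x xs B f) = partial_sum x xs (A `&` B) f.
Proof. exact: partial_sum_comb. Qed.

End Dual.
End Combinations.

(** * Reduction of the three constants to contractivity *)

Section OptimalConstants.
Context (R : realType) (s : scalars) (X : lmodType (scalarField R s)).
Variables (N : X -> R) (x : nat -> X) (xs : nat -> {scalar X}).
Hypothesis qN : quasi_norm N.
Hypothesis biorth : forall n k, xs n (x k) = (k == n)%:R.

(** The normalised first basis vector shows that each of the three constants is at least [1]: the
    singleton [[set 0%N]] is a greedy set of [u], and the projection onto it and both truncations
    along it fix [u]. *)
Let u := ((N (x 0%N))^-1)%:K *: x 0%N.

Let Nx0_gt0 : 0 < N (x 0%N).
Proof.
have [N_ge0 N_eq0 _ _] := qN; rewrite lt_def N_ge0 andbT; apply/eqP => /N_eq0 x0.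
by have /esym/eqP := biorth 0 0; rewrite x0 raddf0 oner_eq0.
Qed.

Let Nu : N u = 1.
Proof.
have [_ _ NZ _] := qN.
by rewrite NZ modulus_of_real gtr0_norm ?invr_gt0 // mulVf // gt_eqF.
Qed.

Let coef_u n : xs n u = if n \in [set 0%N] then ((N (x 0%N))^-1)%:K else 0.
Proof.
rewrite linearZ /= biorth; case: ifPn => [|n0].
  by rewrite inE => ->; rewrite eqxx mulr1.
by case: eqP => [E|_]; [rewrite -E mem_set in n0|rewrite mulr0].
Qed.

Let greedy_u A : A `<=` [set 0%N] -> greedy xs u A.
Proof.
move=> A0 n k An nAk; have n0 := A0 n An; rewrite !coef_u (mem_set n0).
rewrite memNset ?modulus0 ?modulus_ge0 // => k0.
by apply: nAk; rewrite k0 -n0.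
Qed.

Let trunc_U_u : trunc_U x xs u [set 0%N] = u.
Proof.
rewrite /trunc_U asboolT // image_set1 inf1 fsbig_set1 coef_u mem_set //.
rewrite scalerA /u; congr (_ *: _).
by rewrite modulus_mul_sign.
Qed.

Lemma C_qg_eq1 : (forall f A B, finite_set A -> greedy xs f A -> greedy xs f B ->
    B `<=` A -> N (partial_sum x xs (A `\` B) f) <= N f) -> C_qg N x xs = 1%E.
Proof.
move=> bound; apply/eqP; rewrite eq_le; apply/andP; split.
  apply: ereal_inf_lbound; exists 1 => // f A B fA gA gB BA /=.
  by rewrite mul1r bound.
apply: le_ereal_inf_tmp => _ [C /= HC <-]; rewrite lee_fin.
have := HC u [set 0%N] set0 (finite_set1 _) (greedy_u (@subset_refl _ _))
  (greedy_u (@sub0set _ _)) (@sub0set _ _).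
rewrite setD0 /partial_sum fsbig_set1 coef_u mem_set // -/u.
by rewrite Nu mulr1.
Qed.

Lemma Lambda_u_eq1 : (forall f A, greedy xs f A -> N (trunc_U x xs f A) <= N f) ->
  Lambda_u N x xs = 1%E.
Proof.
move=> bound; apply/eqP; rewrite eq_le; apply/andP; split.
  apply: ge_ereal_sup => _ [f [A [gA f1 ->]]].
  by rewrite lee_fin (le_trans (bound _ _ gA)).
apply: ereal_sup_ubound; exists u, [set 0%N].
by rewrite trunc_U_u Nu; split=> //; exact: greedy_u.
Qed.

Lemma Lambda_t_eq1 : (forall f A, greedy xs f A -> N (trunc_T x xs f A) <= N f) ->
  Lambda_t N x xs = 1%E.
Proof.
move=> bound; apply/eqP; rewrite eq_le; apply/andP; split.
  apply: ge_ereal_sup => _ [f [A [gA f1 ->]]].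
  by rewrite lee_fin (le_trans (bound _ _ gA)).
apply: ereal_sup_ubound; exists u, [set 0%N].
rewrite /trunc_T asboolT // trunc_U_u /partial_sum fsbig_set1 coef_u mem_set //.
by rewrite subrr addr0 Nu; split=> //; exact: greedy_u.
Qed.

End OptimalConstants.

(** * Two elementary facts, on sums of indicators and on powers *)

Lemma sum_ltn_indicator (R : pzRingType) d b :
  \sum_(j < b) (if (j < d)%N then 1 else 0) = (minn d b)%:R :> R.
Proof.
elim: b => [|b IHb]; first by rewrite big_ord0 minn0.
rewrite big_ord_recr /= IHb; case: ltnP => [bd|db].
  by rewrite (minn_idPr bd) natr1.
by rewrite addr0 (minn_idPl (leqW db)).
Qed.

(** By Bernoulli's inequality. *)
Lemma exprn_unbounded (R : realType) (d y : R) : 0 < d -> exists n, y < (1 + d) ^+ n.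
Proof.
move=> d0; have bernoulli n : 1 + n%:R * d <= (1 + d) ^+ n.
  elim: n => [|n IHn]; first by rewrite mul0r addr0.
  have nd : 0 <= n%:R * d * d by rewrite !mulr_ge0 // ltW.
  apply: (@le_trans _ _ ((1 + d) * (1 + n%:R * d))); first by rewrite -natr1; lra.
  by rewrite exprS ler_pM2l // addr_gt0.
exists (Num.truncn (y / d)).+1; apply: lt_le_trans (bernoulli _).
by rewrite ltr_wpDl // -ltr_pdivrMr // truncnS_gt.
Qed.

(** * Consequences of the quasi-triangle inequality *)

Section QuasiNormTheory.
Context (R : realType) (s : scalars) (X : lmodType (scalarField R s)).
Variables (N : X -> R) (kappa : R).
Hypothesis N_ge0 : forall f, 0 <= N f.
Hypothesis NZ : forall a f, N (a *: f) = modulus a * N f.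
Hypothesis kappa_ge1 : 1 <= kappa.
Hypothesis ND : forall f g, N (f + g) <= kappa * (N f + N g).

Lemma quasi_norm0 : N 0 = 0.
Proof. by rewrite -(scale0r 0) NZ modulus0 mul0r. Qed.

Lemma quasi_normN f : N (- f) = N f.
Proof. by rewrite -scaleN1r NZ modulusN modulus1 mul1r. Qed.

Lemma quasi_normB f g : N (f - g) <= kappa * (N f + N g).
Proof. by rewrite -(quasi_normN g) ND. Qed.

(** Each term that is split off costs one factor [kappa]. The bound is exponential in [m], so it
    gives uniform estimates only for a fixed number of terms. *)
Lemma quasi_norm_sum m (g : nat -> X) M : (forall j, (j < m)%N -> N (g j) <= M) ->
  N (\sum_(j < m) g j) <= kappa ^+ m * (m%:R * M).
Proof.
elim: m => [|m IHm] gM; first by rewrite big_ord0 quasi_norm0 mul0r mulr0.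
have k0 : 0 < kappa by apply: lt_le_trans kappa_ge1.
have M0 : 0 <= M by apply: le_trans (N_ge0 _) (gM 0 isT).
rewrite big_ord_recr /=; apply: le_trans (ND _ _) _.
rewrite exprS -mulrA ler_pM2l // -natr1 mulrDl mul1r mulrDr lerD //.
  by apply: IHm => j jm; apply: gM; rewrite ltnS ltnW.
by apply: le_trans (gM m _) _; rewrite // ler_peMl // exprn_ege1.
Qed.

End QuasiNormTheory.

(** * Sums with unimodular coefficients and their perturbations *)

Section QuasiGreedy.
Context (R : realType) (s : scalars) (X : lmodType (scalarField R s)).
Variables (N : X -> R) (x : nat -> X) (xs : nat -> {scalar X}).
Variables (kappa C : R).
Hypothesis N_ge0 : forall f, 0 <= N f.
Hypothesis NZ : forall a f, N (a *: f) = modulus a * N f.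
Hypothesis kappa_ge1 : 1 <= kappa.
Hypothesis ND : forall f g, N (f + g) <= kappa * (N f + N g).
Hypothesis biorth : forall n k, xs n (x k) = (k == n)%:R.
Hypothesis C_ge1 : 1 <= C.
Hypothesis N_greedy : forall f A, finite_set A -> greedy xs f A ->
  N (partial_sum x xs A f) <= C * N f.

Notation K := (scalarField R s).
Notation S := (partial_sum x xs).
Notation comb := (comb x).
Implicit Types (f g : X) (A B D : set nat) (e : nat -> K) (a : nat -> R) (t : R).

Let kappa_gt0 : 0 < kappa. Proof. exact: lt_le_trans kappa_ge1. Qed.
Let C_gt0 : 0 < C. Proof. exact: lt_le_trans C_ge1. Qed.

Let NZr t f : 0 <= t -> N (t%:K *: f) = t * N f.
Proof. by move=> t0; rewrite NZ modulus_of_real ger0_norm. Qed.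

(* All nonzero coefficients of the larger sum have modulus one, hence [B] is one
   of its greedy sets. *)
Lemma unimodular_comb_subset e A B : finite_set A -> B `<=` A ->
  (forall n, A n -> modulus (e n) = 1) -> N (comb e B) <= C * N (comb e A).
Proof.
move=> fA BA e1; have fB := sub_finite_set BA fA.
rewrite -{1}(setIidl BA) -(partial_sum_comb biorth) //; apply: N_greedy => //.
move=> n k Bn nBk; rewrite !(coef_comb biorth) // (mem_set (BA _ Bn)).
rewrite (e1 _ (BA _ Bn)); case: ifPn => [|_]; last by rewrite modulus0.
by rewrite inE => /e1 ->.
Qed.

(* Writing [a n] to one digit in a base [b >= 2 kappa] bounds the supremum [W] of
   the left-hand side over all [a] by a constant multiple of the norm on the
   right plus [W / 2]. *)
Lemma comb_unit_interval : exists2 L, 0 < L & forall e a A, finite_set A ->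
  (forall n, A n -> modulus (e n) = 1) -> (forall n, A n -> 0 <= a n <= 1) ->
  N (comb (fun n => (a n)%:K * e n) A) <= L * N (comb e A).
Proof.
pose b := (Num.truncn (2 * kappa)).+1.
have b2k : 2 * kappa <= b%:R by apply/ltW/truncnS_gt.
have b0 : 0 < b%:R :> R by rewrite ltr0n.
exists (2 * kappa ^+ b.+1 * C); first by do 2![apply: mulr_gt0 => //]; rewrite ?exprn_gt0.
move=> e a0 A fA e1 a01.
pose M := N (comb e A).
pose W := [set N (comb (fun n => (a n)%:K * e n) A) |
            a in [set a : nat -> R | forall n, A n -> 0 <= a n <= 1]].
(* This bound depends on [A]; it only makes [sup W] a genuine supremum, so that [sup W / 2] can be
   absorbed at the end. *)
have Wub : has_ubound W.
  have [m Am] := finite_set_nat_bound fA.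
  exists (kappa ^+ m * (m%:R * \sum_(k < m) N (x k))) => _ [a /= a1 <-].
  rewrite (comb_ord _ _ Am).
  apply: (quasi_norm_sum N_ge0 NZ kappa_ge1 ND
    (g := fun k => (if k \in A then (a k)%:K * e k else 0) *: x k)) => k km.
  rewrite (bigD1 (Ordinal km)) //= -[leLHS]addr0 lerD ?sumr_ge0 // NZ.
  case: ifPn => [|_]; last by rewrite modulus0 mul0r.
  rewrite inE => Ak; rewrite modulusM e1 // mulr1 modulus_of_real.
  have /andP[ak0 ak1] := a1 _ Ak.
  by rewrite ger0_norm // ler_piMl.
have digit a : (forall n, A n -> 0 <= a n <= 1) ->
    N (comb (fun n => (a n)%:K * e n) A) <= kappa ^+ b.+1 * C * M + sup W / 2.
  (* Here [a = (d + r) / b]. Since [d n] counts the [j < b] with [j < d n], the part with [d] is a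
     sum of [b] subsums of [comb e A], each bounded by [C * M]. The fractional part [r] is again
     admissible in [W], which bounds its sum by [sup W]. *)
  move=> a1; pose d n := Num.truncn (b%:R * a n).
  pose r n := b%:R * a n - (d n)%:R.
  have ba0 n : A n -> 0 <= b%:R * a n.
    by move=> /a1/andP[? _]; rewrite mulr_ge0 // ltW.
  have r01 n : A n -> 0 <= r n <= 1.
    move=> An; have /andP[dl du] := truncn_itv (ba0 n An).
    by rewrite /r subr_ge0 dl /= lerBlDr addrC natr1 ltW.
  have db n : A n -> (d n <= b)%N.
    move=> An; rewrite -(ler_nat R); apply: (@le_trans _ _ (b%:R * a n)).
      by rewrite truncn_le ba0.
    by have /andP[_ ?] := a1 _ An; rewrite ler_piMr // ltW.
  have dsum n : A n -> (d n)%:R = \sum_(j < b) (if (j < d n)%N then 1 else 0) :> R.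
    by move=> An; rewrite sum_ltn_indicator (minn_idPl (db n An)).
  have -> : comb (fun n => (a n)%:K * e n) A = (b%:R^-1)%:K *:
      (\sum_(j < b) comb e [set n | A n /\ (j < d n)%N] +
       comb (fun n => (r n)%:K * e n) A).
    rewrite (eq_bigr (fun j : 'I_b =>
        comb (fun n => if n \in [set n | A n /\ (j < d n)%N] then e n else 0) A));
      last by move=> j _; apply: comb_widen => n [].
    rewrite -(comb_sum x b (fun j n =>
      if n \in [set n | A n /\ (j < d n)%N] then e n else 0) fA) -combD // combZ //.
    apply: eq_comb => n An.
    rewrite (eq_bigr (fun j : 'I_b => (if (j < d n)%N then 1 else 0)%:K * e n)).
      rewrite -mulr_suml -of_real_sum -dsum // -mulrDl -of_realD mulrA -of_realM.
      by rewrite /r addrC subrK mulKf // gt_eqF.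
    move=> j _; case: ltnP => jd; first by rewrite mem_set // of_real1 mul1r.
    by rewrite memNset ?of_real0 ?mul0r // => -[_]; rewrite ltnNge jd.
  have Nsum : N (\sum_(j < b) comb e [set n | A n /\ (j < d n)%N]) <=
      kappa ^+ b * (b%:R * (C * M)).
    apply: (quasi_norm_sum N_ge0 NZ kappa_ge1 ND
      (g := fun j => comb e [set n | A n /\ (j < d n)%N])) => j _.
    by apply: unimodular_comb_subset => // n [].
  have Nr : N (comb (fun n => (r n)%:K * e n) A) <= sup W.
    by apply: ub_le_sup => //; exists r.
  rewrite NZr ?ler_pdivrMl ?invr_ge0 ?ler0n //; apply: le_trans (ND _ _) _.
  have supW0 : 0 <= sup W by apply: le_trans Nr.
  apply: (@le_trans _ _ (kappa * (kappa ^+ b * (b%:R * (C * M)) + sup W))).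
    by rewrite ler_pM2l // lerD.
  have E : b%:R * (kappa ^+ b.+1 * C * M) = kappa * (kappa ^+ b * (b%:R * (C * M))).
    by rewrite exprS; ring.
  rewrite mulrDr [leRHS]mulrDr E; have := ler_wpM2r supW0 b2k; lra.
have supW : sup W <= kappa ^+ b.+1 * C * M + sup W / 2.
  apply: ge_sup; first by eexists; exists a0.
  by move=> _ [a /= a1 <-]; apply: digit.
have -> : 2 * kappa ^+ b.+1 * C * N (comb e A) =
    kappa ^+ b.+1 * C * M + kappa ^+ b.+1 * C * M by rewrite -/M; ring.
by move: (digit _ a01) supW; move: (kappa ^+ b.+1 * C * M) => q; lra.
Qed.

(** The two sums differ by [d] times a sum with coefficients in [0, 1] times the signs. The choice
    of [d] makes [kappa] times this error at most half of [N (comb e A)], which is absorbed into the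
    left-hand side. *)
Lemma comb_near_unimodular : exists2 d, 0 < d & forall e a A, finite_set A ->
  (forall n, A n -> modulus (e n) = 1) -> (forall n, A n -> 1 <= a n <= 1 + d) ->
  N (comb e A) <= 2 * kappa * N (comb (fun n => (a n)%:K * e n) A).
Proof.
have [L L0 NL] := comb_unit_interval.
have kL0 : 0 < 2 * kappa * L by rewrite !mulr_gt0.
pose d := (2 * kappa * L)^-1.
have d0 : 0 < d by rewrite invr_gt0.
exists d => // e a A fA e1 a1.
pose r n := (a n - 1) / d.
have r01 n : A n -> 0 <= r n <= 1.
  move=> /a1/andP[al au]; rewrite /r divr_ge0 ?subr_ge0 ?(ltW d0) //=.
  by rewrite ler_pdivrMr // mul1r lerBlDl.
have E : comb e A = comb (fun n => (a n)%:K * e n) A -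
    d%:K *: comb (fun n => (r n)%:K * e n) A.
  apply/eqP; rewrite eq_sym subr_eq; apply/eqP.
  rewrite combZ // -combD //; apply: eq_comb => n An.
  have dr : d * r n = a n - 1 by rewrite /r mulrC divfK // gt_eqF.
  rewrite mulrA -of_realM dr -[X in X + _]mul1r -mulrDl.
  by rewrite -(of_real1 R s) -of_realD addrC subrK.
have := quasi_normB NZ ND (comb (fun n => (a n)%:K * e n) A)
  (d%:K *: comb (fun n => (r n)%:K * e n) A).
rewrite -E NZr ?(ltW d0) //; have := NL _ _ _ fA e1 r01.
move: (N (comb (fun n => (r n)%:K * e n) A)) => u uL.
suff: kappa * (d * u) <= N (comb e A) / 2.
  by rewrite mulrDr; move: (kappa * (d * u)) => v; lra.
apply: (@le_trans _ _ (kappa * (d * (L * N (comb e A))))).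
  by rewrite !ler_pM2l.
rewrite /d le_eqVlt; apply/orP; left; apply/eqP; field.
by rewrite !gt_eqF.
Qed.

(** * Level sets of the coefficients and the bound for sign sums *)

Definition level f A t u := [set n | A n /\ t <= modulus (xs n f) < u].
Notation sgn f := (fun n => sign (xs n f)).

Lemma greedy_superlevel f A t : greedy xs f A ->
  greedy xs f [set n | A n /\ t <= modulus (xs n f)].
Proof.
move=> gA n k [An tn] kN; have [Ak|nAk] := pselect (A k); last exact: gA.
apply: le_trans tn; rewrite leNgt; apply/negP => /ltW tk; exact: kN.
Qed.

(** A level is the difference of two nested superlevel sets within [A], and both are greedy. *)
Lemma partial_sum_level f A t u : finite_set A -> greedy xs f A -> t <= u ->
  N (S (level f A t u) f) <= 2 * kappa * C * N f.
Proof.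
move=> fA gA tu.
have fs v : finite_set [set n | A n /\ v <= modulus (xs n f)].
  by apply: sub_finite_set fA => n [].
have -> : level f A t u = [set n | A n /\ t <= modulus (xs n f)] `\`
    [set n | A n /\ u <= modulus (xs n f)].
  apply/seteqP; split => n /=.
    move=> [An /andP[tn nu]]; split=> // -[_].
    by rewrite leNgt nu.
  move=> [[An tn] nu]; split => //; rewrite tn ltNge; apply/negP => un.
  exact: nu.
rewrite partial_sum_setD //; last first.
  by move=> n [An un]; split => //; exact: le_trans un.
apply: le_trans (quasi_normB NZ ND _ _) _.
have -> : 2 * kappa * C * N f = kappa * (C * N f + C * N f) by ring.
by rewrite ler_pM2l // lerD // N_greedy //; exact: greedy_superlevel.
Qed.

(** On a level of ratio [1 + d] the moduli divided by [t] lie in [1, 1 + d], so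
    [comb_near_unimodular] compares the sign sum with the projection of [f] onto the level. *)
Lemma sign_sum_level : exists2 d, 0 < d & exists2 c, 0 < c &
  forall f A t, finite_set A -> greedy xs f A -> 0 < t ->
  N (t%:K *: comb (sgn f) (level f A t ((1 + d) * t))) <= c * N f.
Proof.
have [d d0 Nd] := comb_near_unimodular.
exists d => //; exists (2 * kappa * (2 * kappa * C)); first by rewrite !mulr_gt0.
move=> f A t fA gA t0.
have fL u v : finite_set (level f A u v) by apply: sub_finite_set fA => n [].
have tdt : t <= (1 + d) * t by rewrite mulrDl mul1r lerDl mulr_ge0 // ltW.
have /= := Nd (sgn f) (fun n => modulus (xs n f) / t) _ (fL t ((1 + d) * t))
  (fun n _ => modulus_sign (xs n f)).
rewrite NZr ?(ltW t0) // => H.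
apply: le_trans (_ : t * (2 * kappa * (t^-1 * N (S (level f A t ((1 + d) * t)) f))) <= _).
  rewrite ler_pM2l //; apply: le_trans (H _) _.
    move=> n [_ /andP[tn nt]]; rewrite ler_pdivlMr // mul1r tn /=.
    by rewrite ler_pdivrMr // ltW.
  suff E : t^-1%:K *: S (level f A t ((1 + d) * t)) f = comb (fun n =>
      (modulus (xs n f) / t)%:K * sign (xs n f)) (level f A t ((1 + d) * t)).
    by rewrite -E NZr // invr_ge0 ltW.
  rewrite [LHS]combZ //; apply: eq_comb => n _.
  by rewrite mulrC of_realM -mulrA [_%:K * sign _]mulrC mulrA modulus_mul_sign.
have -> : t * (2 * kappa * (t^-1 * N (S (level f A t ((1 + d) * t)) f))) =
    2 * kappa * N (S (level f A t ((1 + d) * t)) f) by field; rewrite gt_eqF.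
by rewrite -[leRHS]mulrA ler_pM2l ?mulr_gt0 //; apply: partial_sum_level.
Qed.

(** Consecutive levels of ratio [1 + d] are joined until their total ratio exceeds [2 * kappa]. The
    constant grows with the number of levels, but that number depends only on [kappa] and [d]. *)
Lemma sign_sum_wide_level : exists2 q, 2 * kappa <= q & exists2 c, 0 < c &
  forall f A t, finite_set A -> greedy xs f A -> 0 < t ->
  N (t%:K *: comb (sgn f) (level f A t (q * t))) <= c * N f.
Proof.
have [d d0 [c c0 Nc]] := sign_sum_level.
have d1 : 1 <= 1 + d by rewrite lerDl ltW.
suff window r : exists2 c', 0 < c' & forall f A t,
    finite_set A -> greedy xs f A -> 0 < t ->
    N (t%:K *: comb (sgn f) (level f A t ((1 + d) ^+ r * t))) <= c' * N f.
  have [r kr] := exprn_unbounded (2 * kappa) d0.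
  by exists ((1 + d) ^+ r); [exact: ltW|exact: window].
elim: r => [|r [c' c'0 Nc']].
  exists 1 => // f A t fA gA t0.
  rewrite comb_eq0 ?scaler0 ?(quasi_norm0 NZ) ?mul1r //.
  by move=> n [_ /andP[tn /(le_lt_trans tn)]]; rewrite ltxx.
exists (kappa * (c' + c)); first by rewrite mulr_gt0 // addr_gt0.
move=> f A t fA gA t0; set u := (1 + d) ^+ r * t.
have u0 : 0 < u by rewrite mulr_gt0 // exprn_gt0 // (lt_le_trans ltr01).
have tu : t <= u by rewrite ler_peMl ?(ltW t0) // exprn_ege1.
have fL v w : finite_set (level f A v w) by apply: sub_finite_set fA => n [].
have -> : level f A t ((1 + d) ^+ r.+1 * t) = level f A t u `|` level f A u ((1 + d) * u).
  apply/seteqP; split=> n /=; rewrite /level /= exprS -mulrA -/u.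
    move=> [An /andP[tn nu]]; have [un|nu'] := leP u (modulus (xs n f)).
      by right; rewrite nu.
    by left; rewrite tn.
  move=> [[An /andP[tn nu]]|[An /andP[tn nu]]]; split=> //.
    by rewrite tn (lt_le_trans nu) // ler_peMl // ltW.
  by rewrite nu (le_trans tu).
rewrite combU //; last first.
  apply/seteqP; split=> // n [[_ /andP[_ nu]] [_ /andP[un _]]].
  by move: (le_lt_trans un nu); rewrite ltxx.
rewrite scalerDr; apply: le_trans (ND _ _) _.
rewrite -[leRHS]mulrA ler_pM2l // [leRHS]mulrDl lerD //; first exact: Nc'.
(* The upper level is estimated at its own height [u], which is at least [t]. *)
rewrite NZr ?(ltW t0) //; apply: le_trans (Nc f A u fA gA u0).
by rewrite NZr ?(ltW u0) // ler_wpM2r.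
Qed.

(** The constant [2 * kappa * c] reproduces itself when the lowest wide level is split off. The
    rest, at height [q * t], has this bound by induction; returning to height [t] divides it by
    [q >= 2 * kappa], leaving at most [c]. Together with the bound [c] for the lowest level, the
    quasi-triangle inequality gives [kappa * (c + c)] again. *)
Lemma sign_sum_greedy : exists2 M, 0 < M & forall f A t,
  finite_set A -> greedy xs f A -> 0 < t ->
  (forall n, A n -> t <= modulus (xs n f)) ->
  N (t%:K *: comb (sgn f) A) <= M * N f.
Proof.
have [q kq [c c0 Nc]] := sign_sum_wide_level.
have q0 : 0 < q by apply: lt_le_trans kq; rewrite mulr_gt0.
have q2 : 2 <= q by apply: le_trans kq; rewrite ler_peMr.
exists (2 * kappa * c); first by rewrite !mulr_gt0.
(* [J] is a number of wide levels sufficient to cover the moduli on [A]; the bound must not depend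
   on it. *)
suff bounded_ratio J f A t : finite_set A -> greedy xs f A -> 0 < t ->
    (forall n, A n -> t <= modulus (xs n f) < q ^+ J * t) ->
    N (t%:K *: comb (sgn f) A) <= 2 * kappa * c * N f.
  move=> f A t fA gA t0 tA; have [m Am] := finite_set_nat_bound fA.
  have q1 : 0 < q - 1 by rewrite subr_gt0 (lt_le_trans _ q2) // ltr1n.
  have [J] := exprn_unbounded ((\sum_(k < m) modulus (xs k f)) / t) q1.
  rewrite addrC subrK ltr_pdivrMr // => qJ.
  apply: (bounded_ratio J) => // n An; rewrite tA //=; apply: le_lt_trans qJ.
  rewrite (bigD1 (Ordinal (Am _ An))) //= lerDl sumr_ge0 // => k _.
  exact: modulus_ge0.
elim: J f A t => [|J IHJ] f A t fA gA t0 tA.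
  rewrite comb_eq0 ?scaler0 ?(quasi_norm0 NZ) ?mulr_ge0 ?(ltW c0) ?(ltW kappa_gt0) //.
  by move=> n /tA /andP[tn]; rewrite expr0 mul1r => /(le_lt_trans tn); rewrite ltxx.
set B := [set n | A n /\ q * t <= modulus (xs n f)].
have fB : finite_set B by apply: sub_finite_set fA => n [].
have fL : finite_set (level f A t (q * t)) by apply: sub_finite_set fA => n [].
have -> : A = level f A t (q * t) `|` B.
  apply/seteqP; split=> [n An|n [[]|[]]//].
  have /andP[tn _] := tA _ An.
  by case: (leP (q * t) (modulus (xs n f))) => nq; [right|left; rewrite /level /= tn].
rewrite combU //; last first.
  apply/seteqP; split=> // n [[_ /andP[_ nu]] [_ un]].
  by move: (le_lt_trans un nu); rewrite ltxx.
rewrite scalerDr; apply: le_trans (ND _ _) _.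
have HB : N ((q * t)%:K *: comb (sgn f) B) <= 2 * kappa * c * N f.
  apply: IHJ => //; [exact: greedy_superlevel|exact: mulr_gt0|].
  move=> n [An qn]; rewrite qn /= mulrA -exprSr.
  by have /andP[] := tA _ An.
have {}HB : N (t%:K *: comb (sgn f) B) <= c * N f.
  have kt : kappa * (2 * N (t%:K *: comb (sgn f) B)) <= kappa * (2 * (c * N f)).
    apply: le_trans (_ : 2 * kappa * c * N f <= _); last first.
      by rewrite le_eqVlt; apply/orP; left; apply/eqP; ring.
    apply: le_trans HB; rewrite !NZr ?mulr_ge0 ?(ltW t0) ?(ltW q0) // !mulrA.
    by rewrite !ler_wpM2r ?(ltW t0) // mulrC.
  by move: kt; rewrite !ler_pM2l.
have := Nc f A t fA gA t0.
have -> : 2 * kappa * c * N f = kappa * (c * N f + c * N f) by ring.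
by move=> ?; rewrite ler_pM2l // lerD.
Qed.

(** The set [B] is enlarged to the part of [A] where the moduli are at least [t]; that part is
    greedy, and its sign sum dominates the one over [B]. *)
Lemma sign_sum_subset_greedy : exists2 M, 0 < M & forall f A B t,
  finite_set A -> greedy xs f A -> B `<=` A -> 0 < t ->
  (forall n, B n -> t <= modulus (xs n f)) ->
  N (t%:K *: comb (sgn f) B) <= M * N f.
Proof.
have [M M0 NM] := sign_sum_greedy.
exists (C * M); first exact: mulr_gt0.
move=> f A B t fA gA BA t0 tB.
pose D := [set n | A n /\ t <= modulus (xs n f)].
have fD : finite_set D by apply: sub_finite_set fA => n [].
rewrite NZr ?(ltW t0) //.
apply: le_trans (_ : C * N (t%:K *: comb (sgn f) D) <= _).
  rewrite NZr ?(ltW t0) // mulrCA ler_pM2l //.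
  apply: unimodular_comb_subset => // [n Bn|n _]; last exact: modulus_sign.
  by split; [exact: BA|exact: tB].
rewrite -mulrA ler_pM2l //; apply: NM => //; first exact: greedy_superlevel.
by move=> n [].
Qed.

(** * Iterated greedy operators and their closed form *)

Inductive reach f : X -> Prop :=
| reach_refl : reach f f
| reach_partial_sum h D : reach f h -> finite_set D -> greedy xs h D ->
    reach f (S D h)
| reach_remainder h D : reach f h -> finite_set D -> greedy xs h D ->
    reach f (h - S D h)
| reach_trunc h D n0 : reach f h -> finite_set D -> greedy xs h D ->
    D n0 -> xs n0 h != 0 ->
    (forall n, D n -> modulus (xs n0 h) <= modulus (xs n h)) ->
    reach f ((modulus (xs n0 h))%:K *: comb (sgn h) D + (h - S D h)).

Lemma reach_trans f g h : reach f g -> reach g h -> reach f h.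
Proof.
move=> fg; elim=> // {h} h D.
- by move=> _ fh fD gD; exact: reach_partial_sum.
- by move=> _ fh fD gD; exact: reach_remainder.
- by move=> n0 _ fh fD gD Dn0 n00 nmin; exact: reach_trunc.
Qed.

Lemma greedyZ c f D : greedy xs f D -> greedy xs (c *: f) D.
Proof.
move=> gD n k Dn nDk; rewrite !linearZ /= !modulusM ler_wpM2l ?modulus_ge0 //.
exact: gD.
Qed.

Lemma reachZ c f h : c != 0 -> reach f h -> reach (c *: f) (c *: h).
Proof.
move=> c0; elim=> [|{}h D _ IH fD gD|{}h D _ IH fD gD|{}h D n0 _ IH fD gD Dn0 n00 nmin].
- exact: reach_refl.
- by rewrite -partial_sumZ //; apply: reach_partial_sum => //; exact: greedyZ.
- rewrite scalerBr -partial_sumZ //; apply: reach_remainder => //; exact: greedyZ.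
have cmin n : D n -> modulus (xs n0 (c *: h)) <= modulus (xs n (c *: h)).
  by move=> Dn; rewrite !linearZ /= !modulusM ler_wpM2l ?modulus_ge0 // nmin.
have cn0 : xs n0 (c *: h) != 0 by rewrite linearZ /= mulf_neq0.
suff -> : c *: ((modulus (xs n0 h))%:K *: comb (sgn h) D + (h - S D h)) =
   (modulus (xs n0 (c *: h)))%:K *: comb (sgn (c *: h)) D + (c *: h - S D (c *: h)).
  by apply: reach_trunc => //; exact: greedyZ.
rewrite scalerDr scalerBr -partial_sumZ //; congr (_ + _).
rewrite !combZ //; apply: eq_comb => n Dn.
(* The coefficients on [D] are nonzero, so [sign] is multiplicative here in spite of
   [sign 0 = 1]. *)
have hn0 : xs n h != 0 by rewrite -modulus_gt0 (lt_le_trans _ (nmin _ Dn)) ?modulus_gt0.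
rewrite !linearZ /= signM // modulusM of_realM -{1}(modulus_mul_sign c).
by rewrite mulrACA -!mulrA; congr (_ * _); rewrite mulrCA.
Qed.

(* For infinite [E] only the case [E = setT] matters, see [greedy_range]. *)
Definition greedy_proj E f := if `[< finite_set E >] then S E f else f.

(** The case [setT] encodes that no projection has been applied yet; afterwards only the
    coefficients in a finite greedy set can survive. *)
Definition greedy_range f E := E = setT \/ finite_set E /\ greedy xs f E.

Lemma coef_greedy_proj f E n : greedy_range f E ->
  xs n (greedy_proj E f) = if n \in E then xs n f else 0.
Proof.
rewrite /greedy_proj => -[->|[fE _]].
  by rewrite asboolF ?in_setT //; exact: infinite_nat.
by rewrite asboolT // coef_partial_sum.
Qed.

Lemma partial_sum_greedy_proj D f E : finite_set D -> greedy_range f E ->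
  S D (greedy_proj E f) = S (D `&` E) f.
Proof.
move=> fD gE; rewrite [RHS](@comb_widen _ _ _ _ _ D); last exact: subIsetl.
apply: eq_comb => n Dn; rewrite coef_greedy_proj // in_setI.
by rewrite (mem_set Dn).
Qed.

(* The elements of [reach f] in closed form: the coefficients of [f] outside [E]
   are removed, those in [A] are removed or, on [B], replaced by [m] times their
   sign, and all others are kept. *)
Definition truncated f h := exists A B E m,
  [/\ finite_set A /\ greedy xs f A, B `<=` A, greedy_range f E /\ A `<=` E,
    [/\ 0 < m, (forall n, B n -> m <= modulus (xs n f)) &
      forall n k, B n -> E k -> ~ A k -> modulus (xs k f) <= m]
  & h = m%:K *: comb (sgn f) B + (greedy_proj E f - S A f)].

(** The sign sum is controlled by [sign_sum_subset_greedy]; the remaining part is a difference of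
    two vectors, each a greedy projection of [f] or [f] itself. *)
Lemma truncated_bound : exists2 M, 0 < M & forall f h, truncated f h -> N h <= M * N f.
Proof.
have [M M0 NM] := sign_sum_subset_greedy.
exists (kappa * (M + 2 * kappa * C)); first by rewrite mulr_gt0 // addr_gt0 ?mulr_gt0.
move=> f h [A [B [E [m [[fA gA] BA [gE AE] [m0 mB _] ->]]]]].
have Nproj : N (greedy_proj E f) <= C * N f.
  rewrite /greedy_proj; case: asboolP => [fE|_]; last by rewrite ler_peMl.
  case: gE => [E_T|[_ ?]]; last exact: N_greedy.
  by case: infinite_nat; rewrite -E_T.
have Ntail : N (greedy_proj E f - S A f) <= 2 * kappa * C * N f.
  apply: le_trans (quasi_normB NZ ND _ _) _.
  have -> : 2 * kappa * C * N f = kappa * (C * N f + C * N f) by ring.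
  by rewrite ler_pM2l // lerD // N_greedy.
apply: le_trans (ND _ _) _.
rewrite -[leRHS]mulrA ler_pM2l // [leRHS]mulrDl lerD //.
exact: (NM f A).
Qed.

Lemma coef_truncated f A B E m n : finite_set A -> B `<=` A ->
  greedy_range f E -> A `<=` E ->
  xs n (m%:K *: comb (sgn f) B + (greedy_proj E f - S A f)) =
  if n \in B then m%:K * sign (xs n f) else
  if n \in E `\` A then xs n f else 0.
Proof.
move=> fA BA gE AE; have fB := sub_finite_set BA fA.
rewrite raddfD raddfB /= linearZ /= coef_greedy_proj // coef_partial_sum //.
rewrite (coef_comb biorth) //; case: ifPn => [|_].
  by rewrite inE => /[dup] /BA An /BA /AE En; rewrite !mem_set // subrr addr0.
rewrite mulr0 add0r in_setD; case: ifPn => [_|nE].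
  by case: ifPn => _; rewrite ?subrr ?subr0.
by case: ifPn => [|_]; rewrite ?subrr ?subr0 //= inE => /AE /mem_set En; rewrite En in nE.
Qed.

Lemma partial_sum_setU_setI f A E D : finite_set A -> finite_set D -> A `<=` E ->
  S (A `|` (D `&` E)) f = S A f + (S (D `&` E) f - S (D `&` A) f).
Proof.
move=> fA fD AE.
have fDE : finite_set (D `&` E) by apply: sub_finite_set fD; exact: subIsetl.
rewrite -partial_sum_setD //; last by move=> n [? /AE].
have -> : A `|` (D `&` E) = A `|` ((D `&` E) `\` (D `&` A)).
  apply/seteqP; split=> n /=; last by move=> [|[]]; [left|right].
  move=> [An|[Dn En]]; first by left.
  by have [An|nA] := pselect (A n); [left|right; split=> // -[]].
rewrite {1}/partial_sum [LHS]combU //; first exact: finite_setD.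
by apply/seteqP; split=> // n [An [[Dn En]]]; apply.
Qed.

(** Each operator along [D] preserves the closed form. A projection shrinks [E] to the union of [A]
    and [D] intersected with [E], and a remainder or a truncation enlarges [A] to that union; a
    truncation also adds [D] to [B]. The crux is that this union is again a greedy set of [f]. *)
Lemma reach_truncated f h : reach f h -> truncated f h.
Proof.
have fin_union A E D : finite_set A -> finite_set D -> finite_set (A `|` (D `&` E)).
  move=> fA fD; rewrite finite_setU; split=> //.
  by apply: sub_finite_set fD; exact: subIsetl.
(* Indices outside [E] are compared through the greediness of [E]. On [E] without [A], the vectors
   [h'] and [g] have the same coefficients, so there the greediness of [D] for [h'] applies. *)
have greedy_union g h' A B E m D : greedy_range g E -> finite_set A -> greedy xs g A ->
    B `<=` A -> A `<=` E -> h' = m%:K *: comb (sgn g) B + (greedy_proj E g - S A g) ->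
    greedy xs h' D -> greedy xs g (A `|` (D `&` E)).
  move=> gE fA gA BA AE hE gD n k [An|[Dn En]] /not_orP[nAk nDEk]; first exact: gA.
  have [An|nAn] := pselect (A n); first exact: gA.
  have [Ek|nEk] := pselect (E k); last first.
    by case: gE => [E_T|[_ gE]]; [case: nEk; rewrite E_T|exact: gE].
  have := gD n k Dn (fun Dk => nDEk (conj Dk Ek)).
  have notB j : ~ A j -> j \in B = false by move=> nAj; apply: memNset => /BA.
  by rewrite hE !coef_truncated // !notB // !mem_set.
have remainder g h' A B E m D : greedy_range g E -> finite_set A ->
    B `<=` A -> A `<=` E -> h' = m%:K *: comb (sgn g) B + (greedy_proj E g - S A g) ->
    finite_set D -> h' - S D h' = m%:K *: comb (sgn g) (B `\` D) +
      (greedy_proj E g - S (A `|` (D `&` E)) g).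
  move=> gE fA BA AE -> fD; have fB := sub_finite_set BA fA.
  rewrite partial_sumD // partial_sumB // partial_sumZ // partial_sum_greedy_proj //.
  rewrite partial_sum_comb // partial_sum_partial_sum // partial_sum_setU_setI //.
  have -> : B `\` D = B `\` (D `&` B) by rewrite setDIr setDv setU0.
  rewrite comb_setD //.
  by rewrite scalerBr opprD addrACA; congr (_ + _); rewrite [in RHS]opprD addrA.
elim=> {h} [|h D _ IH fD gD|h D _ IH fD gD|h D n0 _ IH fD gD Dn0 n00 nmin].
(* Nothing is removed from [f] itself; [m = 1] is an arbitrary positive number, as [B] is empty. *)
- exists set0, set0, setT, 1; split; [by split|by []|by split=> //; left|by split|].
  rewrite comb0 scaler0 add0r /greedy_proj asboolF; last exact: infinite_nat.
  by rewrite [S _ _]comb0 subr0.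
- case: IH => A [B [E [m [[fA gA] BA [gE AE] [m0 mB mE] hE]]]].
  exists A, (B `&` D), (A `|` (D `&` E)), m; split=> //.
  + by move=> n [/BA].
  + split; last exact: subsetUl.
    right; split; first exact: fin_union.
    exact: (greedy_union _ _ _ _ _ _ _ gE fA gA BA AE hE gD).
  + split=> // [n [Bn _]|n k [Bn _] [|[_ Ek]] nAk //]; first exact: mB.
    exact: mE Bn Ek nAk.
  have fB := sub_finite_set BA fA.
  rewrite hE partial_sumD // partial_sumB // partial_sumZ // partial_sum_greedy_proj //.
  rewrite partial_sum_comb // partial_sum_partial_sum // setIC; congr (_ + _).
  rewrite /greedy_proj asboolT; last exact: fin_union.
  by rewrite partial_sum_setU_setI // [RHS]addrC addKr.
- case: IH => A [B [E [m [[fA gA] BA [gE AE] [m0 mB mE] hE]]]].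
  have fB := sub_finite_set BA fA; have fU := fin_union A E D fA fD.
  have gU := greedy_union _ _ _ _ _ _ _ gE fA gA BA AE hE gD.
  exists (A `|` (D `&` E)), (B `\` D), E, m; split=> //.
  + by move=> n [/BA An _]; left.
  + by split=> // n [/AE|[]].
  + split=> // [n [Bn _]|n k [Bn _] Ek /not_orP[nAk _]]; first exact: mB.
    exact: mE Bn Ek nAk.
  exact: (remainder _ _ _ _ _ _ _ gE fA BA AE hE fD).
case: IH => A [B [E [m [[fA gA] BA [gE AE] [m0 mB mE] hE]]]].
have fB := sub_finite_set BA fA; have fU := fin_union A E D fA fD.
have gU := greedy_union _ _ _ _ _ _ _ gE fA gA BA AE hE gD.
have coefh n : xs n h = if n \in B then m%:K * sign (xs n f) else
    if n \in E `\` A then xs n f else 0 by rewrite hE coef_truncated.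
set mu := modulus (xs n0 h).
have mu0 : 0 < mu by rewrite modulus_gt0.
have coefB n : B n -> modulus (xs n h) = m.
  move=> Bn; rewrite coefh mem_set // modulusM modulus_sign mulr1.
  by rewrite modulus_of_real gtr0_norm.
(* The coefficients of [h] on [D] are nonzero, so [D] lies in its support, hence in [B] or in [E]
   without [A]. *)
have D_cases n : D n -> B n \/ [/\ ~ B n, E n, ~ A n & xs n h = xs n f].
  move=> Dn; have [Bn|nB] := pselect (B n); [by left|right].
  have := lt_le_trans mu0 (nmin _ Dn); rewrite coefh memNset //.
  by case: ifPn => [|_]; rewrite ?modulus0 ?ltxx // inE => -[En nAn].
have signD n : D n -> sign (xs n h) = sign (xs n f).
  move=> /D_cases[Bn|[_ _ _ -> //]].
  by rewrite coefh mem_set // sign_of_real_mul // modulus_sign.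
have muf n : D n -> mu <= modulus (xs n f).
  move=> Dn; apply: le_trans (nmin _ Dn) _; case: (D_cases _ Dn) => [Bn|[_ _ _ -> //]].
  by rewrite coefB // mB.
(* If [D] does not exhaust [B], then it consists of coefficients of modulus [m]. *)
have mu_m n : B n -> ~ D n -> mu = m.
  move=> Bn nDn; apply/eqP; rewrite eq_le -{2}(coefB _ Bn) (gD n0 n Dn0 nDn) andbT.
  rewrite /mu; case: (D_cases _ Dn0) => [Bn0|[_ En0 nAn0 ->]]; first by rewrite coefB.
  exact: mE Bn En0 nAn0.
(* Any part of [B] left outside [D] keeps the height [m], which then equals [mu]; so it joins [D] in
   a single sign sum. *)
exists (A `|` (D `&` E)), (D `|` (B `\` D)), E, mu; split=> //.
- move=> n [Dn|[/BA An _]]; last by left.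
  by case: (D_cases _ Dn) => [/BA An|[_ En _ _]]; [left|right].
- by split=> // n [/AE|[]].
- split=> // [n [|[Bn nDn]]|n k _ Ek /not_orP[nAk nDEk]]; first exact: muf.
    by rewrite (mu_m _ Bn nDn) mB.
  have nDk : ~ D k by move=> Dk; apply: nDEk.
  apply: le_trans (gD _ _ Dn0 nDk); rewrite coefh memNset; last by move=> /BA.
  by rewrite mem_set.
rewrite (remainder _ _ _ _ _ _ _ gE fA BA AE hE fD) combU //; last first.
- by apply/seteqP; split=> // n [Dn [_ nDn]].
- exact: finite_setD.
rewrite scalerDr -addrA; congr (_ + (_ + _)).
  by rewrite !combZ //; apply: eq_comb => n Dn; rewrite signD.
have fBD : finite_set (B `\` D) by exact: finite_setD.
by rewrite !combZ //; apply: eq_comb => n [Bn nDn]; rewrite (mu_m _ Bn nDn).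
Qed.

Lemma reach_bound : exists2 M, 0 < M & forall f h, reach f h -> N h <= M * N f.
Proof.
have [M M0 NM] := truncated_bound.
by exists M => // f h /reach_truncated /NM.
Qed.

(** * The new quasi-norm and its equivalence with the old one *)

Definition greedy_norm f := sup [set N h | h in reach f].

Lemma greedy_norm_ub f h : reach f h -> N h <= greedy_norm f.
Proof.
move=> fh; have [M _ NM] := reach_bound.
apply: ub_le_sup; last by exists h.
by exists (M * N f) => _ [g /= /NM ? <-].
Qed.

Lemma greedy_norm_le f r : (forall h, reach f h -> N h <= r) -> greedy_norm f <= r.
Proof.
move=> fr; apply: ge_sup; last by move=> _ [g /= /fr ? <-].
by exists (N f), f => //; exact: reach_refl.
Qed.

Lemma le_greedy_norm f : N f <= greedy_norm f.
Proof. exact/greedy_norm_ub/reach_refl. Qed.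

(** Iterates of an iterate are iterates, so the supremum for [g] runs over a smaller set.
    Contractivity of an operator thus reduces to its values being reachable. *)
Lemma greedy_norm_reach f g : reach f g -> greedy_norm g <= greedy_norm f.
Proof.
by move=> fg; apply: greedy_norm_le => h gh; apply/greedy_norm_ub/(reach_trans fg).
Qed.

Lemma greedy_norm_equiv : exists2 M, 0 < M & forall f, greedy_norm f <= M * N f.
Proof.
have [M M0 NM] := reach_bound; exists M => // f.
by apply: greedy_norm_le => h /NM.
Qed.

Lemma greedy_norm_eq0 f : N f = 0 -> greedy_norm f = 0.
Proof.
move=> f0; have [M _ /(_ f)] := greedy_norm_equiv; rewrite f0 mulr0 => le0.
by apply/eqP; rewrite eq_le le0 -f0 le_greedy_norm.
Qed.

(** For [c != 0], [reachZ] gives one inequality; applied to [c^-1] and [c *: f] it gives the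
    other. *)
Lemma greedy_normZ c f : greedy_norm (c *: f) = modulus c * greedy_norm f.
Proof.
have [->|c0] := eqVneq c 0.
  by rewrite scale0r modulus0 mul0r greedy_norm_eq0 // (quasi_norm0 NZ).
have scale_le d g : d != 0 -> modulus d * greedy_norm g <= greedy_norm (d *: g).
  move=> d0; have md0 : 0 < modulus d by rewrite modulus_gt0.
  rewrite mulrC -ler_pdivlMr //; apply: greedy_norm_le => h gh.
  by rewrite ler_pdivlMr // mulrC -NZ greedy_norm_ub //; exact: reachZ.
apply/eqP; rewrite eq_le scale_le // andbT.
have := scale_le c^-1 (c *: f); rewrite scalerK // invr_neq0 // => /(_ isT).
rewrite -(ler_pM2l (_ : 0 < modulus c)) ?modulus_gt0 // mulrA -modulusM.
by rewrite mulfV // modulus1 mul1r.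
Qed.

Lemma renorming_greedy_norm : (forall f, N f = 0 -> f = 0) -> renorming N greedy_norm.
Proof.
move=> N_eq0; have [M M0 NM] := greedy_norm_equiv; split; [split|].
- by move=> f; apply: le_trans (le_greedy_norm f).
- by move=> f f0; apply: N_eq0; apply/eqP; rewrite eq_le N_ge0 andbT -f0 le_greedy_norm.
- exact: greedy_normZ.
(* The inequality is inherited from [N] through the equivalence; [1 + M] in place of [M] ensures a
   constant of at least [1]. *)
- exists (kappa * (1 + M)) => [|f g].
    by rewrite mulr_ege1 // lerDl ltW.
  apply: le_trans (NM _) _; apply: (@le_trans _ _ (M * (kappa * (N f + N g)))).
    by rewrite ler_pM2l.
  rewrite mulrCA -mulrA ler_pM2l //; apply: ler_pM.
  + exact: ltW.
  + by rewrite addr_ge0.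
  + by rewrite lerDr.
  + by rewrite lerD // le_greedy_norm.
- move=> f; apply/seteqP; split=> V [e /= e0 eV].
    exists (e / M) => [|g]; rewrite /= ?divr_gt0 // /qball /= => fg.
    by apply: eV; apply: le_lt_trans (NM _) _; rewrite mulrC -ltr_pdivlMr.
  exists e => // g; rewrite /qball /= => fg.
  by apply: eV; apply: le_lt_trans fg; exact: le_greedy_norm.
Qed.

(** * Contractivity of the greedy operators for the new quasi-norm *)

Lemma trunc_U_finite f A : finite_set A ->
  trunc_U x xs f A = 0 \/ exists n0, [/\ A n0, xs n0 f != 0,
    (forall n, A n -> modulus (xs n0 f) <= modulus (xs n f)) &
    trunc_U x xs f A = (modulus (xs n0 f))%:K *: comb (sgn f) A].
Proof.
move=> fA; rewrite /trunc_U asboolT //.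
have [->|/set0P[n1 An1]] := eqVneq A set0.
  by left; rewrite [X in _ *: X]comb0 scaler0.
have [m Am] := finite_set_nat_bound fA.
have [i /set_mem Ai imin] := @arg_minP _ _ _ (Ordinal (Am _ An1))
  (fun i => nat_of_ord i \in A) (fun i => modulus (xs i f)) (mem_set An1).
have fmin n : A n -> modulus (xs i f) <= modulus (xs n f).
  by move=> An; exact: (imin (Ordinal (Am _ An)) (mem_set An)).
have -> : inf [set modulus (xs n f) | n in A] = modulus (xs i f).
  apply/eqP; rewrite eq_le; apply/andP; split.
    apply: ge_inf; last by exists i.
    by exists 0 => _ [n _ <-]; exact: modulus_ge0.
  apply: lb_le_inf; first by exists (modulus (xs i f)), i.
  by move=> _ [n An <-]; exact: fmin.
(* A zero minimum, like an empty [A], makes [U] vanish, and [T] is then just the remainder; this is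
   why [reach_trunc] can demand a nonzero minimum. *)
have [f0|f0] := eqVneq (xs i f) 0; last by right; exists i.
by left; rewrite f0 modulus0 of_real0 scale0r.
Qed.

Lemma reach_trunc_T f A : finite_set A -> greedy xs f A -> reach f (trunc_T x xs f A).
Proof.
move=> fA gA; rewrite /trunc_T asboolT //.
have [->|[n0 [An0 f0 fmin ->]]] := trunc_U_finite f fA.
  by rewrite add0r; apply: reach_remainder => //; exact: reach_refl.
by apply: reach_trunc => //; exact: reach_refl.
Qed.

(** A nonzero [U(f, A)] is the projection of [T(f, A)] onto [A]. This set is greedy for [T(f, A)]
    too: the coefficients on [A] all have the minimal modulus of those of [f] on [A], which
    dominates the moduli outside. *)
Lemma reach_trunc_U f A : finite_set A -> greedy xs f A ->
  trunc_U x xs f A = 0 \/ reach f (trunc_U x xs f A).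
Proof.
move=> fA gA; have [->|[n0 [An0 f0 fmin E]]] := trunc_U_finite f fA; [by left|right].
have := reach_trunc_T fA gA; rewrite /trunc_T asboolT // => fT.
have coefT n : xs n (trunc_U x xs f A + (f - S A f)) =
    if n \in A then (modulus (xs n0 f))%:K * sign (xs n f) else xs n f.
  rewrite E raddfD raddfB /= linearZ /= (coef_comb biorth) // coef_partial_sum //.
  by case: ifPn => _; rewrite ?subrr ?addr0 // mulr0 add0r subr0.
have -> : trunc_U x xs f A = S A (trunc_U x xs f A + (f - S A f)).
  rewrite [RHS](@eq_comb _ _ _ _ _ (fun n => (modulus (xs n0 f))%:K * sign (xs n f))).
    by rewrite E combZ.
  by move=> n An; rewrite coefT mem_set.
apply: reach_partial_sum => // n k An nAk; rewrite !coefT (mem_set An) (memNset nAk).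
rewrite modulusM modulus_sign mulr1 modulus_of_real ger0_norm ?modulus_ge0 //.
exact: gA.
Qed.

(** This is the remainder along [B] of the projection of [f] onto [A], and [B] is greedy for that
    projection. *)
Lemma reach_partial_sum_setD f A B : finite_set A -> greedy xs f A ->
  greedy xs f B -> B `<=` A -> reach f (S (A `\` B) f).
Proof.
move=> fA gA gB BA; have fB := sub_finite_set BA fA.
rewrite partial_sum_setD // -{1}(setIidl BA) -partial_sum_partial_sum //.
apply: reach_remainder => //; first exact: reach_partial_sum (reach_refl f) fA gA.
move=> n k Bn nBk; rewrite !coef_partial_sum // (mem_set (BA _ Bn)).
by case: ifPn => _; [exact: gB|rewrite modulus0 modulus_ge0].
Qed.

Lemma greedy_norm_optimal : (forall f, N f = 0 -> f = 0) ->
  [/\ renorming N greedy_norm, C_qg greedy_norm x xs = 1%E,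
      Lambda_t greedy_norm x xs = 1%E & Lambda_u greedy_norm x xs = 1%E].
Proof.
move=> N_eq0; have rN := renorming_greedy_norm N_eq0; have [qN _] := rN.
(* Covers the cases where an operator vanishes: infinite [A], and the first alternative of
   [reach_trunc_U]. *)
have le0 f : greedy_norm 0 <= greedy_norm f.
  by rewrite greedy_norm_eq0 ?(quasi_norm0 NZ) // (le_trans (N_ge0 f)) ?le_greedy_norm.
split=> //.
- apply: C_qg_eq1 => // f A B fA gA gB BA.
  exact/greedy_norm_reach/reach_partial_sum_setD.
- apply: Lambda_t_eq1 => // f A gA.
  have [fA|iA] := pselect (finite_set A); first exact/greedy_norm_reach/reach_trunc_T.
  by rewrite /trunc_T asboolF.
apply: Lambda_u_eq1 => // f A gA.
have [fA|iA] := pselect (finite_set A); last by rewrite /trunc_U asboolF.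
by have [->|/greedy_norm_reach] := reach_trunc_U fA gA.
Qed.

End QuasiGreedy.
End Renorming.

Theorem theorem11p2 (R : realType) (s : scalars)
    (X : lmodType (scalarField R s)) (N : X -> R)
    (x : nat -> X) (xs : nat -> {scalar X}) :
  quasi_banach N -> quasi_greedy_basis N x xs ->
  exists N' : X -> R,
    [/\ renorming N N',
        C_qg N' x xs = 1%E,
        Lambda_t N' x xs = 1%E
      & Lambda_u N' x xs = 1%E].
Proof.
move=> [[N_ge0 N_eq0 NZ [kappa kappa_ge1 ND]] _] [[_ _ biorth] _ _ [C NC]].
exists (greedy_norm N x xs).
(* The quasi-greedy constant is enlarged to be at least [1], which lets it also bound the
   identity. *)
apply: (@greedy_norm_optimal _ _ _ N x xs kappa (Num.max 1%R C)) => //.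
  by rewrite Order.TotalTheory.le_max ?Order.POrderTheory.lexx.
move=> f A fA gA; apply: Order.POrderTheory.le_trans (NC f A fA gA) _.
by rewrite Num.Theory.ler_wpM2r // Order.TotalTheory.le_max Order.POrderTheory.lexx orbT.
Qed.
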